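(* Let $J:C[0,1]\rightrightarrows rca[0,1]$ be the normalized duality mapping of the real Banach space $C[0,1]$. Let $f\in C[0,1]$ and $\lambda\in rca[0,1]$. If $\langle\lambda,f\rangle\neq0$, then, for any $\mu\in J(f)$, we have $$\lambda\notin\widehat{D}^*J(f,\mu)(\theta^{**}).$$
   Context: $C[0,1]$ is the Banach space of continuous real functions on $[0,1]$ with the maximum norm $\|\cdot\|$; its dual $C^*[0,1]=rca[0,1]$ is the space of regular countably additive real-valued measures on the Borel $\sigma$-field $\Sigma$ of $[0,1]$, with pairing $\langle\mu,f\rangle=\int_0^1 f(s)\,\mu(ds)$ and norm $\|\mu\|_*=v(\mu,[0,1])$, the total variation of $\mu$ (the dual norm). $rca^*[0,1]=C^{**}[0,1]$ is the dual of $rca[0,1]$, with pairing $\langle\cdot,\cdot\rangle_*$ and origin $\theta^{**}$. The normalized duality mapping is $J(f)=\{\mu\in rca[0,1]:\langle\mu,f\rangle=\|f\|^2=\|\mu\|_*^2\}$. For $\mu\in J(f)$, the Mordukhovich derivative of $J$ at $(f,\mu)$ is defined, for $\Phi\in C^{**}[0,1]$, by $$\widehat{D}^*J(f,\mu)(\Phi)=\left\{\lambda\in rca[0,1]:\ \limsup_{(g,\gamma)\to(f,\mu),\ g\in C[0,1],\ \gamma\in J(g)}\frac{\langle\lambda,g-f\rangle-\langle\Phi,\gamma-\mu\rangle_*}{\|g-f\|+\|\gamma-\mu\|_*}\le0\right\},$$ with convergence in the norms and $(g,\gamma)\neq(f,\mu)$. *)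

(* Defs.v *)
From HB Require Import structures.
From mathcomp Require Import all_boot all_order all_algebra.
From mathcomp Require Import all_classical all_reals all_analysis.

Set Implicit Arguments.
Unset Strict Implicit.
Unset Printing Implicit Defensive.

Import Order.TTheory GRing.Theory Num.Theory.
Import numFieldNormedType.Exports.

Local Open Scope classical_set_scope.
Local Open Scope ring_scope.

Definition I01 (R : realType) : Type := set_type (`[0, 1]%classic : set R).

HB.instance Definition _ (R : realType) := Topological.on (I01 R).

Lemma I01_zero_subproof (R : realType) : (0 : R) \in (`[0, 1]%classic : set R).
Proof. by rewrite inE /= in_itv /= lexx ler01. Qed.

HB.instance Definition _ (R : realType) :=
  isPointed.Build (I01 R) (exist _ 0 (@I01_zero_subproof R)).

Definition borel01 (R : realType) := g_sigma_algebraType (@open (I01 R)).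

Definition C01 (R : realType) : Type := continuousType (I01 R) R.

HB.instance Definition _ (R : realType) := Choice.on (C01 R).

Section C01_space.
Context {R : realType}.
Implicit Types f g h : C01 R.

Definition C01_fun f : I01 R -> R := f : continuousType (I01 R) R.
Coercion C01_fun : C01 >-> Funclass.

Lemma C01_cts f : continuous (f : I01 R -> R).
Proof. exact: (@cts_fun _ _ (f : continuousType (I01 R) R)). Qed.

Lemma C01P f g : (f : I01 R -> R) =1 g -> f = g.
Proof. by have [_] := @continuousEP _ _ (f : continuousType _ _) g; apply. Qed.

Definition C01_mk (f : I01 R -> R) (cf : continuous f) : C01 R :=
  (mkcts cf : continuousType (I01 R) R).

Lemma C01_zero_cts : continuous (fun _ : I01 R => 0 : R).
Proof. exact: cst_continuous. Qed.

Lemma C01_opp_cts f : continuous (fun x => - f x).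
Proof. by move=> x; apply: continuousN; exact: C01_cts. Qed.

Lemma C01_add_cts f g : continuous (fun x => f x + g x).
Proof. by move=> x; apply: continuousD; exact: C01_cts. Qed.

Lemma C01_scale_cts (r : R) f : continuous (fun x => r * f x).
Proof. by move=> x; apply: continuousM; [exact: (@cst_continuous (I01 R) R r)|exact: C01_cts]. Qed.

Definition C01_zero : C01 R := C01_mk C01_zero_cts.
Definition C01_opp f : C01 R := C01_mk (@C01_opp_cts f).
Definition C01_add f g : C01 R := C01_mk (@C01_add_cts f g).
Definition C01_scale (r : R) f : C01 R := C01_mk (@C01_scale_cts r f).

Fact C01_addA : associative C01_add.
Proof. by move=> f g h; apply: C01P => x /=; exact: addrA. Qed.

Fact C01_addC : commutative C01_add.
Proof. by move=> f g; apply: C01P => x; exact: addrC. Qed.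

Fact C01_add0 : left_id C01_zero C01_add.
Proof. by move=> f; apply: C01P => x; exact: add0r. Qed.

Fact C01_addN : left_inverse C01_zero C01_opp C01_add.
Proof. by move=> f; apply: C01P => x; exact: addNr. Qed.

HB.instance Definition _ :=
  GRing.isZmodule.Build (C01 R) C01_addA C01_addC C01_add0 C01_addN.

Fact C01_scaleA a b f : C01_scale a (C01_scale b f) = C01_scale (a * b) f.
Proof. by apply: C01P => x; exact: mulrA. Qed.

Fact C01_scale1 : left_id 1 C01_scale.
Proof. by move=> f; apply: C01P => x; exact: mul1r. Qed.

Fact C01_scaleDr : right_distributive C01_scale +%R.
Proof. by move=> a f g; apply: C01P => x; exact: mulrDr. Qed.

Fact C01_scaleDl f : {morph C01_scale^~ f : a b / a + b}.
Proof. by move=> a b; apply: C01P => x; exact: mulrDl. Qed.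

HB.instance Definition _ := GRing.Zmodule_isLmodule.Build R (C01 R)
  C01_scaleA C01_scale1 C01_scaleDr C01_scaleDl.

Lemma C01_zeroE x : C01_fun 0 x = 0. Proof. by []. Qed.
Lemma C01_oppE f x : C01_fun (- f) x = - f x. Proof. by []. Qed.
Lemma C01_addE f g x : C01_fun (f + g) x = f x + g x. Proof. by []. Qed.
Lemma C01_scaleE (r : R) f x : C01_fun (r *: f) x = r * f x. Proof. by []. Qed.

Definition C01_norm f : R := sup (range (fun x : I01 R => `|f x|)).

(* The supremum defining the norm is a maximum, by compactness of [0,1]. *)
Lemma C01_norm_max f : exists2 x, C01_norm f = `|f x| & forall y, `|f y| <= `|f x|.
Proof.
pose F : R -> R := valL_ (0 : R) (f : (`[0, 1]%classic : set R) -> R).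
have Fval (x : I01 R) : F (val x) = f x.
  by rewrite -[RHS](f_equal (fun k => k x) (valLK (0 : R) f)).
have cF : {within `[0, 1], continuous F}.
  by apply/subspace_valL_continuousP'; exact: C01_cts.
have cnF : {within `[0, 1], continuous (fun x => `|F x|)}.
  by move=> x; apply: cvg_norm; exact: cF.
have [c c01 cmax] := EVT_max (@ler01 R) cnF.
have c01' : c \in (`[0, 1]%classic : set R) by rewrite inE.
pose x0 : I01 R := exist _ c c01'.
have x0max y : `|f y| <= `|f x0|.
  rewrite -!Fval; apply: cmax; have := valP y; by rewrite inE.
exists x0 => //; apply/eqP; rewrite eq_le; apply/andP; split.
  by apply: ge_sup => [|_ [y _ <-]//]; exists `|f x0|; exists x0.
by apply: ub_le_sup; [exists `|f x0| => _ [y _ <-]|exists x0].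
Qed.

Lemma C01_norm_ge f x : `|f x| <= C01_norm f.
Proof. by have [y -> ] := C01_norm_max f. Qed.

Fact C01_normD f g : C01_norm (f + g) <= C01_norm f + C01_norm g.
Proof.
have [x -> _] := C01_norm_max (f + g).
by rewrite (le_trans (ler_normD _ _))// lerD// C01_norm_ge.
Qed.

Fact C01_normZ (r : R) f : C01_norm (r *: f) = `|r| * C01_norm f.
Proof.
apply/eqP; rewrite eq_le; apply/andP; split.
  have [x -> _] := C01_norm_max (r *: f).
  by rewrite C01_scaleE normrM ler_wpM2l// C01_norm_ge.
have [x -> _] := C01_norm_max f.
by rewrite -normrM -C01_scaleE C01_norm_ge.
Qed.

Fact C01_norm0_eq0 f : C01_norm f = 0 -> f = 0.
Proof.
move=> f0; apply: C01P => x; apply/eqP; rewrite -normr_le0 -f0.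
exact: C01_norm_ge.
Qed.

HB.instance Definition _ :=
  Lmodule_isNormed.Build R (C01 R) C01_normD C01_normZ C01_norm0_eq0.

End C01_space.

Section charge_variation_norm.
Context d (T : measurableType d) {R : realType}.
Implicit Type nu : {charge set T -> \bar R}.

Lemma hahn_exists nu :
  exists PN : set T * set T, hahn_decomposition nu PN.1 PN.2.
Proof. by have [P [N PN]] := Hahn_decomposition nu; exists (P, N). Qed.

(* The Hahn decomposition is chosen; the measures nu^+, nu^- and |nu| derived
   from it do not depend on the choice (Hahn_decomposition_uniq). The variation
   |nu|(setT) is equal to the supremum of the sums of the |nu E_i| over finite
   measurable partitions. *)
Definition hahn_sets nu : set T * set T := proj1_sig (cid (hahn_exists nu)).

Definition hahnP nu : hahn_decomposition nu (hahn_sets nu).1 (hahn_sets nu).2 :=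
  proj2_sig (cid (hahn_exists nu)).

Definition charge_total_variation nu : R :=
  fine (charge_variation (hahnP nu) setT).

Definition charge_integral nu (f : T -> R) : R :=
  Rintegral (jordan_pos (hahnP nu)) setT f -
  Rintegral (jordan_neg (hahnP nu)) setT f.

Lemma charge_total_variationE nu : (charge_total_variation nu)%:E =
  (`|nu (hahn_sets nu).1| + `|nu (hahn_sets nu).2|)%E.
Proof.
have [[mP P0] [mN N0] _ _] := hahnP nu.
rewrite /charge_total_variation fineK; last by rewrite fin_num_measure.
rewrite /charge_variation /= jordan_posE jordan_negE cjordan_posE cjordan_negE.
rewrite /crestr0 mem_set// /crestr !setTI gee0_abs ?lee0_abs//.
  exact: N0.
exact: P0.
Qed.

Lemma charge_total_variation_ge nu (A : set T) : measurable A ->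
  (`|nu A| + `|nu (~` A)| <= (charge_total_variation nu)%:E)%E.
Proof.
move=> mA; rewrite /charge_total_variation fineK; last by rewrite fin_num_measure.
rewrite -(setUv A) measureU//; last by rewrite setICr.
  by apply: leeD; apply: abse_charge_variation => //; exact: measurableC.
exact: measurableC.
Qed.

Lemma hahn_setC nu : (hahn_sets nu).2 = ~` (hahn_sets nu).1.
Proof.
have [_ _ PN PN0] := hahnP nu; apply/seteqP; split => x.
  by move=> Nx Px; have : set0 x by rewrite -PN0.
by move=> nPx; have : setT x by []; rewrite -PN => -[].
Qed.

End charge_variation_norm.

Lemma charge_eqP d (T : measurableType d) (R : realType)
    (mu nu : {charge set T -> \bar R}) :
  (mu : set T -> \bar R) = nu -> mu = nu.
Proof.
case: mu nu => m [[ma] [mb] [mc]] [n [[na] [nb] [nc]]] /= mn; subst n.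
by rewrite (Prop_irrelevance ma na) (Prop_irrelevance mb nb)
  (Prop_irrelevance mc nc).
Qed.

(* Regularity is the condition of Dunford and Schwartz: E lies between a closed
   and an open set such that nu is small on all measurable subsets of their
   difference.
   Charges of the library are also defined on non-measurable sets, where their
   values are unconstrained: they are fixed to 0 here so that = is equality of
   measures on the Borel sets. *)
Record rca (R : realType) := Rca {
  rca_charge :> {charge set (borel01 R) -> \bar R} ;
  rca_regular : forall (E : set (borel01 R)) (e : R), measurable E -> 0 < e ->
    exists F G : set (I01 R), [/\ closed F, open G, F `<=` E, E `<=` G &
      forall C : set (borel01 R), measurable C -> C `<=` G `\` F ->
        (`|rca_charge C| < e%:E)%E] ;
  rca_nonmeasurable : forall E : set (borel01 R), ~ measurable E ->
    rca_charge E = 0%E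
}.

HB.instance Definition _ (R : realType) := gen_eqMixin (rca R).
HB.instance Definition _ (R : realType) := gen_choiceMixin (rca R).

Section rca_space.
Context {R : realType}.
Implicit Types mu nu rho : rca R.
Local Notation B := (borel01 R).

Lemma rcaP mu nu : (forall A : set B, measurable A -> mu A = nu A) -> mu = nu.
Proof.
move=> munu.
have {munu} : rca_charge mu = rca_charge nu.
  apply/charge_eqP/funext => A.
  have [mA|mA] := pselect (measurable A); first exact: munu.
  by rewrite !rca_nonmeasurable.
case: mu nu => [m mr mn] [n nr nn] /= mnE; subst n.
by rewrite (Prop_irrelevance mr nr) (Prop_irrelevance mn nn).
Qed.

Let regular (m : set B -> \bar R) :=
  forall (E : set B) (e : R), measurable E -> 0 < e ->
    exists F G : set (I01 R), [/\ closed F, open G, F `<=` E, E `<=` G &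
      forall C : set B, measurable C -> C `<=` G `\` F -> (`|m C| < e%:E)%E].

Fact rca_zero_regular : regular (@czero _ B R).
Proof.
move=> E e mE e0; exists set0, setT; split => //.
- exact: closed0.
- exact: openT.
- by move=> C _ _; rewrite /czero abse0 lte_fin.
Qed.

Definition rca_zero : rca R :=
  @Rca R (czero : {charge set B -> \bar R}) rca_zero_regular
    (fun _ _ => erefl).

Fact rca_scale_regular (r : R) mu : regular (cscale r mu).
Proof.
move=> E e mE e0; have r0 : 0 < `|r| + 1 by rewrite ltr_wpDl.
have [F [G [cF oG FE EG FG]]] := rca_regular mu mE (divr_gt0 e0 r0).
exists F, G; split => // C mC CFG; rewrite /cscale abseM abse_EFin.
have /fineK <- : mu C \is a fin_num by exact: fin_num_measure.
have := FG C mC CFG.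
have /fineK <- : mu C \is a fin_num by exact: fin_num_measure.
rewrite !abse_EFin -EFinM !lte_fin ltr_pdivlMr// mulrC => /le_lt_trans; apply.
by rewrite ler_wpM2r// lerDl.
Qed.

Fact rca_scale_nonmeasurable (r : R) mu (E : set B) :
  ~ measurable E -> cscale r mu E = 0%E.
Proof. by move=> mE; rewrite /cscale rca_nonmeasurable// mule0. Qed.

Definition rca_scale (r : R) mu : rca R :=
  @Rca R (cscale r mu : {charge set B -> \bar R})
    (rca_scale_regular r mu) (rca_scale_nonmeasurable r mu).

Fact rca_add_regular mu nu : regular (cadd mu nu).
Proof.
move=> E e mE e0; have e20 : 0 < e / 2 by rewrite divr_gt0.
have [F1 [G1 [cF1 oG1 FE1 EG1 FG1]]] := rca_regular mu mE e20.
have [F2 [G2 [cF2 oG2 FE2 EG2 FG2]]] := rca_regular nu mE e20.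
exists (F1 `|` F2), (G1 `&` G2); split.
- exact: closedU.
- exact: openI.
- by rewrite subUset.
- by rewrite subsetI.
- move=> C mC CFG; rewrite (splitr e) EFinD.
  apply: (le_lt_trans (lee_abs_add _ _)); apply: lteD.
    by apply: FG1 => // x /CFG [[? ?] /not_orP[]].
  by apply: FG2 => // x /CFG [[? ?] /not_orP[]].
Qed.

Fact rca_add_nonmeasurable mu nu (E : set B) :
  ~ measurable E -> cadd mu nu E = 0%E.
Proof. by move=> mE; rewrite /cadd/= !rca_nonmeasurable// adde0. Qed.

Definition rca_add mu nu : rca R :=
  @Rca R (cadd mu nu : {charge set B -> \bar R})
    (rca_add_regular mu nu) (rca_add_nonmeasurable mu nu).

Definition rca_opp mu : rca R := rca_scale (-1) mu.

Fact rca_addA : associative rca_add.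
Proof. by move=> mu nu rho; apply: rcaP => A mA /=; rewrite /cadd/= addeA. Qed.

Fact rca_addC : commutative rca_add.
Proof. by move=> mu nu; apply: rcaP => A mA /=; rewrite /cadd/= addeC. Qed.

Fact rca_add0 : left_id rca_zero rca_add.
Proof. by move=> mu; apply: rcaP => A mA /=; rewrite /cadd/= /czero add0e. Qed.

Fact rca_addN : left_inverse rca_zero rca_opp rca_add.
Proof.
move=> mu; apply: rcaP => A mA /=; rewrite /cadd/= /cscale /czero.
by rewrite EFinN mulN1e addeC subee// fin_num_measure.
Qed.

HB.instance Definition _ :=
  GRing.isZmodule.Build (rca R) rca_addA rca_addC rca_add0 rca_addN.

Fact rca_scaleA a b mu : rca_scale a (rca_scale b mu) = rca_scale (a * b) mu.
Proof. by apply: rcaP => A mA /=; rewrite /cscale/= /cscale EFinM muleA. Qed.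

Fact rca_scale1 : left_id 1 rca_scale.
Proof. by move=> mu; apply: rcaP => A mA /=; rewrite /cscale mul1e. Qed.

Fact rca_scaleDr : right_distributive rca_scale +%R.
Proof.
move=> a mu nu; apply: rcaP => A mA /=; rewrite /cadd/= /cscale/= /cadd/=.
by rewrite muleDr// fin_num_adde_defr// fin_num_measure.
Qed.

Fact rca_scaleDl mu : {morph rca_scale^~ mu : a b / a + b}.
Proof.
move=> a b; apply: rcaP => A mA /=; rewrite /cadd/= /cscale/= EFinD.
by rewrite muleDl ?fin_num_measure.
Qed.

HB.instance Definition _ := GRing.Zmodule_isLmodule.Build R (rca R)
  rca_scaleA rca_scale1 rca_scaleDr rca_scaleDl.

Lemma rca_zeroE (A : set B) : rca_charge 0 A = 0%E.
Proof. by []. Qed.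
Lemma rca_addE mu nu (A : set B) : rca_charge (mu + nu) A = (mu A + nu A)%E.
Proof. by []. Qed.
Lemma rca_scaleE (r : R) mu (A : set B) :
  rca_charge (r *: mu) A = (r%:E * mu A)%E.
Proof. by []. Qed.

Definition rca_norm mu : R := charge_total_variation mu.

Fact rca_normD mu nu : rca_norm (mu + nu) <= rca_norm mu + rca_norm nu.
Proof.
have [[mP _] _ _ _] := hahnP (mu + nu).
rewrite -lee_fin charge_total_variationE hahn_setC EFinD 2!rca_addE.
apply: le_trans (leeD (charge_total_variation_ge mu mP)
  (charge_total_variation_ge nu mP)).
by rewrite addeACA leeD// lee_abs_add.
Qed.

Fact rca_normZ_le (r : R) mu : rca_norm (r *: mu) <= `|r| * rca_norm mu.
Proof.
have [[mP _] _ _ _] := hahnP (r *: mu).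
rewrite -lee_fin charge_total_variationE hahn_setC EFinM 2!rca_scaleE !abseM.
rewrite -muleDr ?ge0_adde_def ?inE//= lee_wpmul2l// ?lee_fin//.
exact: charge_total_variation_ge.
Qed.

Fact rca_normZ (r : R) mu : rca_norm (r *: mu) = `|r| * rca_norm mu.
Proof.
apply/eqP; rewrite eq_le rca_normZ_le/=.
have [->|r0] := eqVneq r 0.
  rewrite normr0 mul0r -lee_fin charge_total_variationE.
  by rewrite adde_ge0.
rewrite -ler_pdivlMl ?normr_gt0// -normfV.
rewrite -[in leLHS](scale1r mu) -(mulVf r0) -scalerA.
exact: rca_normZ_le.
Qed.

Fact rca_norm0_eq0 mu : rca_norm mu = 0 -> mu = 0.
Proof.
move=> mu0; apply: rcaP => A mA; rewrite rca_zeroE.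
apply/eqP; rewrite -abse_eq0 eq_le abse_ge0 andbT.
apply: le_trans (_ : (charge_total_variation mu)%:E <= 0)%E; last first.
  by rewrite -/(rca_norm mu) mu0.
by rewrite (le_trans _ (charge_total_variation_ge mu mA))// leeDl.
Qed.

HB.instance Definition _ :=
  Lmodule_isNormed.Build R (rca R) rca_normD rca_normZ rca_norm0_eq0.

End rca_space.

Record dual_space (R : realType) (V : normedModType R) := Dual {
  dual_fun :> {linear V -> R^o} ;
  dual_cts : continuous dual_fun
}.

Definition dual_space_zero (R : realType) (V : normedModType R) :
    dual_space V :=
  @Dual R V (\0 : {linear V -> R^o}) (@cst_continuous V R^o 0).

Section duality_mapping.
Context {R : realType}.
Implicit Types (f : C01 R) (mu : rca R).

Definition rca_pairing mu f : R := charge_integral mu (f : borel01 R -> R).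

Definition duality_map f : set (rca R) :=
  [set mu | rca_pairing mu f = `|f| ^+ 2 /\ `|f| ^+ 2 = `|mu| ^+ 2].

Definition mordukhovich_derivative (S : C01 R -> set (rca R)) f mu
    (Phi : dual_space (rca R)) : set (rca R) :=
  [set lambda |
    (limf_esup
       (fun p : C01 R * rca R =>
          ((rca_pairing lambda (p.1 - f) - Phi (p.2 - mu))
             / (`|p.1 - f| + `|p.2 - mu|))%:E)
       (within [set p | S p.1 p.2] (f, mu)^') <= 0)%E].

End duality_mapping.

(* Main.v *)
Require Import Defs.
From mathcomp Require Import all_boot all_order all_algebra.
From mathcomp Require Import all_classical all_reals all_analysis.
From mathcomp Require Import measurable_realfun.

(** The duality mapping is positively homogeneous: if [mu] lies in [J(f)], then
    [r mu] lies in [J(r f)] for every [r > 0].  So the graph of [J] contains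
    the whole open ray through [(f, mu)], and its points
    [((1 + s u) f, (1 + s u) mu)], with [s] the sign of [<lambda, f>] and
    [u > 0] small, converge to [(f, mu)] as [u] tends to [0].  For
    [Phi = theta**] the difference quotient at such a point is
    [s u <lambda, f> / (u |f| + u |mu|) = |<lambda, f>| / (|f| + |mu|)],
    a positive constant: [<lambda, f> <> 0] also forces [f <> 0], so the
    denominator does not vanish and these points differ from [(f, mu)].  Hence
    the limsup in the definition of the derivative is positive.

    The technical point is the homogeneity of the pairing in the measure
    ([charge_integral_cscale]): the pairing is defined from a chosen Hahn
    decomposition, and the choices for [mu] and [r mu] may differ, so the
    uniqueness of the Jordan decomposition is used. *)

Set Implicit Arguments.
Unset Strict Implicit.
Unset Printing Implicit Defensive.

Import Order.TTheory GRing.Theory Num.Theory.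
Import numFieldNormedType.Exports.

Local Open Scope classical_set_scope.
Local Open Scope ring_scope.

Lemma limf_esup_ge (T : choiceType) (X : filteredType T) (R : realType)
    (u : X -> \bar R) (F : set_system X) (c : \bar R) :
  (forall V, F V -> exists2 x, V x & (c <= u x)%E) -> (c <= limf_esup u F)%E.
Proof.
move=> Fc; rewrite limf_esupE; apply: le_ereal_inf_tmp => _ [V FV <-].
have [x Vx cux] := Fc V FV.
by apply: (le_trans cux); apply: ereal_sup_ubound; exists x.
Qed.

Section charge_integral_scale.
Context d (T : measurableType d) (R : realType).
Implicit Type nu : {charge set T -> \bar R}.

Lemma Rintegral_mscale (m : {measure set T -> \bar R}) (k : {nonneg R})
    (f : T -> R) : m.-integrable setT (EFin \o f) ->
  Rintegral (mscale k m) setT f = k%:num * Rintegral m setT f.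
Proof.
move=> intf; have /integrableP[mf _] := intf.
rewrite /Rintegral integralE.
rewrite ge0_integral_mscale//; last exact: measurable_funepos.
rewrite ge0_integral_mscale//; last exact: measurable_funeneg.
rewrite -muleBr//; last exact: integrable_add_def.
by rewrite -integralE fineM// integrable_fin_num.
Qed.

Lemma jordan_pos_measurable nu P N (PN : hahn_decomposition nu P N) A :
  measurable A -> jordan_pos PN A = nu (A `&` P).
Proof. by move=> mA; rewrite jordan_posE cjordan_posE /crestr0 mem_set. Qed.

Lemma jordan_neg_measurable nu P N (PN : hahn_decomposition nu P N) A :
  measurable A -> jordan_neg PN A = (- nu (A `&` N))%E.
Proof. by move=> mA; rewrite jordan_negE cjordan_negE /crestr0 mem_set. Qed.

Lemma hahn_decomposition_cscale (r : R) nu P N : 0 < r ->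
  hahn_decomposition (cscale r nu) P N -> hahn_decomposition nu P N.
Proof.
move=> r0 [[mP P0] [mN N0] PN PN0]; split => //; split => // A mA AP.
  by have := P0 A mA AP; rewrite /cscale pmule_rge0.
by have := N0 A mA AP; rewrite /cscale pmule_rle0.
Qed.

(** The Hahn sets chosen for [r nu] may differ from those chosen for [nu], but
    they also form a Hahn decomposition of [nu].  Both choices therefore yield
    the same Jordan parts of [nu], and the Jordan parts of [r nu] are [r] times
    these. *)
Lemma charge_integral_cscale (r : R) nu (f : T -> R) : 0 < r ->
  (forall m : {finite_measure set T -> \bar R},
     m.-integrable setT (EFin \o f)) ->
  charge_integral (cscale r nu) f = r * charge_integral nu f.
Proof.
move=> r0 intf; pose k := NngNum (ltW r0).
have hr := hahn_decomposition_cscale r0 (hahnP (cscale r nu)).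
have uniq := Hahn_decomposition_uniq hr (hahnP nu).
rewrite /charge_integral mulrBr -[in RHS](_ : k%:num = r)//.
rewrite -!Rintegral_mscale//; try exact: intf.
congr (_ - _); rewrite /Rintegral; congr fine;
  apply: eq_measure_integral => A mA _; have [uP uN] := uniq A mA.
- rewrite [LHS]jordan_pos_measurable//.
  rewrite [RHS](_ : _ = r%:E * jordan_pos (hahnP nu) A)%E//.
  by rewrite jordan_pos_measurable// -uP.
- rewrite [LHS]jordan_neg_measurable//.
  rewrite [RHS](_ : _ = r%:E * jordan_neg (hahnP nu) A)%E//.
  by rewrite jordan_neg_measurable// -uN muleN.
Qed.

End charge_integral_scale.

Section duality_mapping_homogeneous.
Context {R : realType}.
Implicit Types (f : C01 R) (mu : rca R).

Lemma measurable_C01 f : measurable_fun setT (f : borel01 R -> R).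
Proof.
apply: (measurability _ (RGenOpens.measurableE R)) => _ [_ [a [b ->] <-]].
rewrite setTI; apply: sub_sigma_algebra.
by move: (@C01_cts R f) => /continuousP; apply; exact: interval_open.
Qed.

Lemma integrable_C01 f (m : {finite_measure set (borel01 R) -> \bar R}) :
  m.-integrable setT (EFin \o (f : borel01 R -> R)).
Proof.
apply: measurable_bounded_integrable => //.
- by rewrite ltey_eq fin_num_measure.
- exact: measurable_C01.
- exists `|f|; split; first exact: num_real.
  by move=> M /ltW fM x _; exact: le_trans (C01_norm_ge f x) fM.
Qed.

Lemma rca_pairingZr (r : R) f mu :
  rca_pairing mu (r *: f) = r * rca_pairing mu f.
Proof.
by rewrite /rca_pairing /charge_integral mulrBr -!RintegralZl//;
  exact: integrable_C01.
Qed.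

Lemma rca_pairingZl (r : R) f mu : 0 < r ->
  rca_pairing (r *: mu) f = r * rca_pairing mu f.
Proof.
by move=> r0; exact: (charge_integral_cscale mu r0 (integrable_C01 f)).
Qed.

Lemma duality_mapZ (r : R) f mu : 0 < r ->
  duality_map f mu -> duality_map (r *: f) (r *: mu).
Proof.
move=> r0 [fmu nfmu]; split; last by rewrite !normrZ !exprMn nfmu.
rewrite rca_pairingZr rca_pairingZl// fmu normrZ gtr0_norm// exprMn.
by rewrite mulrA expr2.
Qed.

End duality_mapping_homogeneous.

Lemma scale_pair_cvg (R : realType) (V W : normedModType R) (s : R) (x : V)
    (y : W) :
  ((1 + s * u) *: x, (1 + s * u) *: y) @[u --> 0^'+] --> (x, y).
Proof.
have s1 : 1 + s * u @[u --> 0^'+] --> (1 + s * 0 : R).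
  apply: cvgD; first exact: cvg_cst.
  by apply: cvgM; [exact: cvg_cst|exact: cvg_at_right_filter cvg_id].
rewrite mulr0 addr0 in s1.
have := cvgZr_tmp (a := x) s1; have := cvgZr_tmp (a := y) s1.
by rewrite !scale1r => sy sx; apply: cvg_pair; [exact: sx|exact: sy].
Qed.

Theorem theorem5p4 (R : realType) (f : C01 R) (lambda : rca R)
    (hlambda : rca_pairing lambda f <> 0) :
  forall mu : rca R, duality_map f mu ->
    ~ mordukhovich_derivative duality_map f mu (dual_space_zero (rca R)) lambda.
Proof.
move=> mu Jfmu; apply/negP; rewrite -ltNge.
set c := rca_pairing lambda f in hlambda *.
have c0 : c != 0 by exact/eqP.
have f0 : f != 0.
  by apply: contra_neq c0 => f0; rewrite /c f0 -(scale0r f) rca_pairingZr mul0r.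
have n0 : 0 < `|f| + `|mu| by rewrite ltr_pwDl// normr_gt0.
apply: (@lt_le_trans _ _ (`|c| / (`|f| + `|mu|))%:E).
  by rewrite lte_fin divr_gt0// normr_gt0.
apply: limf_esup_ge => V FV.
(* The sign of [c] makes the numerator of the quotient positive. *)
pose s := Num.sg c.
have s1 : `|s| = 1 by rewrite normr_sg c0.
have [u [[u0 u1] Vu]] : exists u, (0 < u /\ u < 1) /\
    (((1 + s * u) *: f, (1 + s * u) *: mu) != (f, mu) ->
     duality_map ((1 + s * u) *: f) ((1 + s * u) *: mu) ->
     V ((1 + s * u) *: f, (1 + s * u) *: mu)).
  apply: (@filter_ex _ (0 : R)^'+); apply: filterI; last first.
    exact: (@scale_pair_cvg R _ _ s f mu _ FV).
  by apply: filterI; [exact: nbhs_right_gt|exact: nbhs_right_lt].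
(* [u < 1] keeps the factor positive, as [duality_mapZ] requires. *)
have r0 : 0 < 1 + s * u.
  have := ler_norm (- (s * u)).
  rewrite normrN normrM s1 mul1r (gtr0_norm u0) lerNl => su.
  by rewrite -(subrr 1) ltrD2l (lt_le_trans _ su)// ltrN2.
have fu : (1 + s * u) *: f - f = (s * u) *: f.
  by rewrite scalerDl scale1r addrAC subrr add0r.
have muu : (1 + s * u) *: mu - mu = (s * u) *: mu.
  by rewrite scalerDl scale1r addrAC subrr add0r.
exists ((1 + s * u) *: f, (1 + s * u) *: mu).
  apply: Vu; last exact: duality_mapZ.
  apply: contra_neq f0 => -[fE _]; apply/eqP.
  move/eqP: fE; rewrite -subr_eq0 fu scaler_eq0 => /orP[|//].
  by rewrite mulf_eq0 (gt_eqF u0) orbF -normr_eq0 s1 oner_eq0.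
rewrite /= fu muu subr0 rca_pairingZr -/c !normrZ -mulrDr s1 mul1r.
rewrite (gtr0_norm u0) (mulrAC s u c) -normrEsg lee_fin.
by rewrite invfM mulrA mulfK ?gt_eqF.
Qed.
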